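(* If $x^*$ is an optimization-stationary point of the problem $\min_{x\in\mathcal M}\max_{y\in S}f(x,y)+h(x)-g(y)$, then there exists $y^*\in S$ such that $(x^*,y^* )$ is a game-stationary point of this problem. Conversely, if $(x^*,y^* )$ is a game-stationary point of this problem, then $x^*$ is an optimization-stationary point.
   Context: **Setting.** $\mathbb E_1,\mathbb E_2$ are finite-dimensional Euclidean spaces. $\mathcal M\subset\mathbb E_1$ is a compact Riemannian submanifold (embedded submanifold with the induced metric); its normal space $N_x\mathcal M$ at $x$ is the orthogonal complement of $T_x\mathcal M$ in $\mathbb E_1$. $S\subset\mathbb E_2$ is a (nonempty) compact convex set with normal cone $N_yS$ at $y$. $f:\mathbb E_1\times\mathbb E_2\to\mathbb R$ is continuously differentiable and concave in $y$; $h:\mathbb E_1\to\mathbb R$ and $g:\mathbb E_2\to\mathbb R$ are closed convex (possibly nonsmooth). There are constants $L_x,L_y>0$ and $L_h$ with: $\|\nabla_xf(x_1,y)-\nabla_xf(x_2,y)\|\le L_x\|x_1-x_2\|$ for all $x_1,x_2\in\mathcal M$, $y\in S$; $\|\nabla_yf(x_1,y_1)-\nabla_yf(x_2,y_2)\|^2\le L_y^2(\|x_1-x_2\|^2+\|y_1-y_2\|^2)$ for all $(x_1,y_1),(x_2,y_2)\in\mathcal M\times S$; $h$ is $L_h$-Lipschitz. **Definitions.** The value function is $\Phi(x):=\max_{y\in S}f(x,y)-g(y)$ for $x\in\mathbb E_1$. $\partial$ denotes the Clarke generalized subdifferential (which is the convex subdifferential for convex functions). A point $x^*\in\mathcal M$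 is *optimization-stationary* if $0\in\partial\Phi(x^* )+\partial h(x^* )+N_{x^*}\mathcal M$. A pair $(x^*,y^* )\in\mathcal M\times S$ is *game-stationary* if $0\in\nabla_xf(x^*,y^* )+\partial h(x^* )+N_{x^*}\mathcal M$ and $0\in\nabla_yf(x^*,y^* )-\partial g(y^* )-N_{y^*}S$. *)

(* Defs.v *)
From HB Require Import structures.
From mathcomp Require Import all_boot all_order all_algebra sesquilinear.
From mathcomp Require Import all_classical all_reals all_analysis.

Set Implicit Arguments.
Unset Strict Implicit.
Unset Printing Implicit Defensive.

Import Order.TTheory GRing.Theory Num.Theory.
Import numFieldNormedType.Exports.

Local Open Scope classical_set_scope.
Local Open Scope ring_scope.

HB.mixin Record NormedModule_isEuclidean (R : realType) E
    of NormedModule R E & Vector R E := {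
  inner : {dot E for (@idfun R)} ;
  sqr_norm_inner : forall x : E, `|x| ^+ 2 = inner x x }.

(* Finite-dimensional real inner product spaces; Vector gives the finite
   dimension, and the norm (hence the topology) is the one induced by inner. *)
#[short(type=euclidType)]
HB.structure Definition Euclidean (R : realType) :=
  {E of NormedModule R E & Vector R E & NormedModule_isEuclidean R E}.

Section differentiability.
Context {R : realType}.

(* For finite-dimensional V and open U this is the usual class C^k on U;
   the values of F outside U are irrelevant. *)
Fixpoint class_C {V W : normedModType R} (k : nat) (U : set V) (F : V -> W) :
    Prop :=
  match k with
  | 0 => forall x, U x -> {for x, continuous F}
  | k'.+1 => (forall x, U x -> differentiable F x) /\
             forall v, class_C k' U (fun x => 'd F x v)
  end.

Definition smooth_on {V W : normedModType R} (U : set V) (F : V -> W) :=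
  forall k, class_C k U F.

Context {E : euclidType R}.

(* Riesz representative of the differential. *)
Definition grad (phi : E -> R) (x : E) : E :=
  xget 0 [set w | forall v, 'd (phi : E -> R^o) x v = inner w v].

Lemma gradE (phi : E -> R^o) (x v : E) : 'd phi x v = inner (grad phi x) v.
Proof.
suff [w hw] : exists w : E, forall v, 'd phi x v = inner w v.
  by rewrite /grad; case: xgetP => [y -> /(_ v)//|/(_ w)/(_ hw)].
pose l (w : E) : 'Hom(E, R^o) := linfun (inner w : E -> R^o).
have lE w u : l w u = inner w u by rewrite /l lfunE.
have ll : linear l.
  by move=> a u w; apply/lfunP => z; rewrite add_lfunE scale_lfunE !lE linearPl.
pose L := linfun (HB.pack_for {linear E -> 'Hom(E,R^o)} l (GRing.isLinear.Build _ _ _ _ _ ll)).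
have LE w : L w = l w by rewrite lfunE.
have ker0 : lker L == 0%VS.
  apply/lker0P => u w h.
  have {}h : l u = l w by rewrite -!LE.
  apply/eqP; rewrite -subr_eq0 -normr_eq0 -sqrf_eq0 sqr_norm_inner.
  by rewrite linearBl /= -!lE h subrr.
have full : limg L = fullv.
  apply/eqP; rewrite eqEdim subvf /= limg_dim_eq; last by rewrite (eqP ker0) capv0.
  by rewrite !dimvf /dim /= muln1.
have : (linfun ('d phi x)) \in limg L by rewrite full memvf.
case/memv_imgP => w _ hw; exists w => u.
by rewrite -lE; rewrite -LE -hw lfunE.
Qed.

End differentiability.

Section variational_notions.
Context {R : realType} {E : euclidType R}.

Definition closed_fun (phi : E -> R) :=
  closed [set p : E * R | phi p.1 <= p.2].

(* limsup of (phi (z + t v) - phi z) / t as z --> x and t decreases to 0 *)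
Definition clarke_dirder (phi : E -> R) (x v : E) : \bar R :=
  limf_esup (fun p : E * R => ((phi (p.1 + p.2 *: v) - phi p.1) / p.2)%:E)
            (filter_prod (nbhs x) 0^'+).

Definition clarke_subdiff (phi : E -> R) (x : E) : set E :=
  [set xi | forall v, ((inner xi v)%:E <= clarke_dirder phi x v)%E].

Definition normal_cone (S : set E) (y : E) : set E :=
  [set v | forall z, S z -> inner v (z - y) <= 0].

(* Local defining functions F : U -> R^k, with k the common codimension. *)
Definition embedded_submanifold (M : set E) :=
  exists k : nat, forall x, M x ->
    exists (U : set E) (F : E -> 'rV[R]_k),
      [/\ open U, U x, smooth_on U F,
          M `&` U = [set z | U z /\ F z = 0] &
          range ('d F x) = setT].

(* Velocities at x of smooth curves in M. *)
Definition tangent_space (M : set E) (x : E) : set E :=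
  [set v | exists (c : R -> E) (J : set R),
    [/\ open J /\ J 0, smooth_on J (c : R^o -> E), c @` J `<=` M,
        c 0 = x & derive1 c 0 = v]].

Definition normal_space (M : set E) (x : E) : set E :=
  [set n | forall v, tangent_space M x v -> inner n v = 0].

End variational_notions.

Section minimax.
Context {R : realType} {E1 E2 : euclidType R}.
Variables (M : set E1) (S : set E2).
Variables (f : E1 -> E2 -> R) (h : E1 -> R) (g : E2 -> R).

Definition grad_x (x : E1) (y : E2) : E1 := grad (f ^~ y) x.
Definition grad_y (x : E1) (y : E2) : E2 := grad (f x) y.

(* The supremum is attained when S is nonempty and compact and f, g are
   continuous. *)
Definition value_fun (x : E1) : R := sup [set f x y - g y | y in S].

Definition optimization_stationary (x : E1) :=
  M x /\ exists u v n : E1,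
    [/\ clarke_subdiff value_fun x u, clarke_subdiff h x v,
        normal_space M x n & 0 = u + v + n].

Definition game_stationary (x : E1) (y : E2) :=
  [/\ M x, S y,
      exists v n : E1, [/\ clarke_subdiff h x v, normal_space M x n &
                           0 = grad_x x y + v + n] &
      exists w m : E2, [/\ clarke_subdiff g y w, normal_cone S y m &
                           0 = grad_y x y - w - m]].

End minimax.

(* Main.v *)
(* Let Y(x) be the compact convex set of maximizers of f(x, .) - g over S.  By
   Danskin's argument, the Clarke directional derivative of the value function
   at x in the direction v is the maximum over y in Y(x) of <grad_x f(x, y), v>,
   so its Clarke subdifferential lies in the convex hull of the set C of the
   vectors grad_x f(x, y), y in Y(x).  The set C is already convex: on Y(x) both
   f(x, .) and g are affine along segments, and for y0, y1 in Y(x) the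
   nonnegative function
     x' |-> f(x', t y0 + (1 - t) y1) - t f(x', y0) - (1 - t) f(x', y1)
   vanishes at x, hence has zero gradient there.  A Clarke subgradient u is thus
   grad_x f(x, y) for a single maximizer y.  Finally y belongs to Y(x) iff
   0 is in grad_y f(x, y) - subdiff g(y) - N_S(y), the nontrivial direction
   being a sandwich (Hahn-Banach) argument.  The terms coming from h and from
   the normal space of M are the same in both notions of stationarity. *)
Require Import Defs.
From HB Require Import structures.
From mathcomp Require Import all_boot all_order all_algebra sesquilinear.
From mathcomp Require Import all_classical all_reals all_analysis.
From mathcomp Require Import ring lra.
Import Order.TTheory GRing.Theory Num.Theory.
Import numFieldNormedType.Exports.
Local Open Scope classical_set_scope.
Local Open Scope ring_scope.

Set Implicit Arguments.
Unset Strict Implicit.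
Unset Printing Implicit Defensive.

(** * Euclidean spaces *)

Section euclidean.
Context {R : realType} {E : euclidType R}.

Lemma innerC (x y : E) : inner x y = inner y x.
Proof. by rewrite hermC expr0 mul1r. Qed.

Lemma innerDl (x y z : E) : inner (x + y) z = inner x z + inner y z.
Proof. exact: linearDl. Qed.

Lemma innerBl (x y z : E) : inner (x - y) z = inner x z - inner y z.
Proof. exact: linearBl. Qed.

Lemma innerZl (a : R) (x z : E) : inner (a *: x) z = a * inner x z.
Proof. by rewrite linearZl. Qed.

Lemma innerDr (x y z : E) : inner x (y + z) = inner x y + inner x z.
Proof. exact: linearD. Qed.

Lemma innerBr (x y z : E) : inner x (y - z) = inner x y - inner x z.
Proof. exact: linearB. Qed.

Lemma innerZr (a : R) (x z : E) : inner x (a *: z) = a * inner x z.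
Proof. by rewrite linearZ. Qed.

Lemma inner_eq0 (x : E) : (inner x x == 0) = (x == 0).
Proof. by rewrite -sqr_norm_inner sqrf_eq0 normr_eq0. Qed.

Lemma inner_inj (x y : E) : (forall v, inner x v = inner y v) -> x = y.
Proof.
move=> xy; apply/eqP; rewrite -subr_eq0 -inner_eq0.
by rewrite innerBl xy subrr.
Qed.

Lemma sqr_normB (x y : E) :
  `|x - y| ^+ 2 = `|x| ^+ 2 - 2 * inner x y + `|y| ^+ 2.
Proof. rewrite !sqr_norm_inner !innerBl !innerBr (innerC y x). ring. Qed.

Lemma inner_continuous (w : E) : continuous (inner w : E -> R^o).
Proof.
(* The bound comes from expanding the squares of the norms of [w - v] and [w + v], both nonnegative:
   for [v] in the unit ball this bounds [inner w v] on both sides. *)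
apply/linear_bounded_continuous; exists ((`|w| ^+ 2 + 1) / 2); split.
  exact: num_real.
move=> r hr; apply/nbhs_ballP; exists 1 => //= v.
rewrite -ball_normE /= sub0r normrN => v1.
have v2 : `|v| ^+ 2 <= 1 by rewrite expr_le1// ltW.
have hm := sqr_normB w v; have hp := sqr_normB w (- v).
rewrite normrN -[- v]scaleN1r innerZr in hp.
have := sqr_ge0 `|w - v|; have := sqr_ge0 `|w - -1 *: v|.
by rewrite ler_norml; move=> *; apply/andP; split; lra.
Qed.

(** The map sending [w] to [inner w] is linear and injective from [E] to its dual, which has the
    same dimension, so it is onto. *)
Lemma riesz (l : {linear E -> R^o}) : exists w, forall v, l v = inner w v.
Proof.
pose F (w : E) : 'Hom(E, R^o) := linfun (inner w : E -> R^o).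
have FE w v : F w v = inner w v by rewrite /F lfunE.
have F_lin : linear F.
  move=> a u w; apply/lfunP => v.
  by rewrite add_lfunE scale_lfunE !FE innerDl innerZl.
pose G := linfun (HB.pack_for {linear E -> 'Hom(E, R^o)} F
  (GRing.isLinear.Build _ _ _ _ _ F_lin)).
have GE w : G w = F w by rewrite lfunE.
have G_inj : lker G == 0%VS.
  by apply/lker0P => u w uw; apply: inner_inj => v; rewrite -!FE -!GE uw.
have /memv_imgP[w _ lw] : linfun l \in limg G.
  suff -> : limg G = fullv by exact: memvf.
  apply/eqP; rewrite eqEdim subvf /= limg_dim_eq ?(eqP G_inj) ?capv0//.
  by rewrite !dimvf /dim /= muln1.
by exists w => v; rewrite -FE -GE -lw lfunE.
Qed.

Lemma coord_continuous (i : 'I_(\dim {:E})) :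
  continuous (coord (vbasis {:E}) i : E -> R^o).
Proof.
have [w lw] := riesz (coord (vbasis {:E}) i : {linear E -> R^o}).
rewrite (_ : coord _ _ = inner w :> (E -> R^o)); first exact: inner_continuous.
exact/funext.
Qed.

(** In finite dimension weak continuity is enough: by [riesz], each coordinate in a basis is an
    inner product with a fixed vector. *)
Lemma continuous_inner_all (T : topologicalType) (F : T -> E) (x : T) :
  (forall v, {for x, continuous (fun t => inner (F t) v : R^o)}) ->
  {for x, continuous F}.
Proof.
move=> Fc.
have -> : F = fun t => \sum_(i < \dim {:E})
    coord (vbasis {:E}) i (F t) *: (vbasis {:E})`_i.
  by apply/funext => t; exact/coord_vbasis/memvf.
apply: cvg_big => [|i _]; first exact: add_continuous.
have [w lw] := riesz (coord (vbasis {:E}) i : {linear E -> R^o}).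
apply: cvgZr_tmp; rewrite lw.
under eq_fun do rewrite lw innerC.
by rewrite innerC; exact: Fc.
Qed.

End euclidean.

(** * Convexity *)

Section convexity.
Context {R : realType}.

Lemma conv_line {V : lmodType R} (t : R) (y z : V) :
  t *: z + (1 - t) *: y = y + t *: (z - y).
Proof. by rewrite scalerBr scalerBl scale1r addrCA. Qed.

Lemma convex_setP {V : lmodType R} (A : set V) : convex_set A ->
  forall x y t, A x -> A y -> 0 <= t <= 1 -> A (t *: x + (1 - t) *: y).
Proof.
move=> cA x y t Ax Ay /andP[t0 t1]; apply: set_mem.
by apply: (cA x y (Itv01 t0 t1)); exact: mem_set.
Qed.

Lemma convex_functionP {V : lmodType R} (g : V -> R) :
  convex_function setT g ->
  forall x y t, 0 <= t <= 1 ->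
    g (t *: x + (1 - t) *: y) <= t * g x + (1 - t) * g y.
Proof.
move=> cg x y t /andP[t0 t1].
exact: (cg (Itv01 t0 t1) x y (in_setT _) (in_setT _)).
Qed.

(** A convex function on a parallelotope is bounded by its values at the vertices. Induction on the
    directions: since [c j] is [t - (1 - t)] with [t] in [0, 1], the point lies between the two
    opposite faces through [y + b j] and [y - b j]. *)
Lemma convex_box_bound {V : lmodType R} (g : V -> R) (I : Type) (b : I -> V)
    (r : seq I) (y : V) : convex_function setT g ->
  exists K, forall c : I -> R, (forall i, `|c i| <= 1) ->
    g (y + \sum_(i <- r) c i *: b i) <= K.
Proof.
move=> cg; elim: r y => [|j r IH] y.
  by exists (g y) => c _; rewrite big_nil addr0.
have [K1 hK1] := IH (y + b j); have [K2 hK2] := IH (y - b j).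
exists (Num.max K1 K2) => c c1; rewrite big_cons.
set s := \sum_(i <- r) _; pose t := (1 + c j) / 2.
have t01 : 0 <= t <= 1.
  by rewrite /t; have := c1 j; rewrite ler_norml => /andP[? ?];
     apply/andP; split; lra.
have -> : y + (c j *: b j + s) = t *: (y + b j + s) + (1 - t) *: (y - b j + s).
  rewrite (addrAC y (b j)) (addrAC y (- b j)) addrCA addrC !scalerDr addrACA.
  rewrite -!scalerDr -!scalerDl scalerN -scalerBl subrKC scale1r.
  by congr (_ + _ *: _); rewrite /t; field.
apply: le_trans (convex_functionP cg _ _ t01) _.
have := hK1 c c1; have := hK2 c c1; rewrite -/s.
by move: t01 => /andP[? ?]; rewrite le_max; case: (leP K1 K2) => *;
   apply/orP; [right|left]; nra.
Qed.

(* K plays the role of the graph of the functional constructed so far. *)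
Lemma hahn_banach_step {V : lmodType R} (p : V -> R) (K : set (V * R^o))
    (e : V) :
  convex_function setT p -> K !=set0 -> convex_set K ->
  (forall k, K k -> k.2 <= p k.1) ->
  exists a, forall k t, K k -> k.2 + t * a <= p (k.1 + t *: e).
Proof.
move=> cp [k0 Kk0] cK Kp.
(* [L] collects the lower bounds that negative [t] impose on the slope [a]. Each lies below every
   upper bound imposed by a positive [t], so [sup L] is an admissible slope. *)
pose L := [set x : R | exists k s, [/\ K k, 0 < s &
  x = (k.2 - p (k.1 - s *: e)) / s]].
have LU x k t : L x -> K k -> 0 < t -> x <= (p (k.1 + t *: e) - k.2) / t.
  move=> [k' [s [Kk' s0 ->]]] Kk t0.
  rewrite ler_pdivrMr// mulrAC ler_pdivlMr//.
  have st0 : 0 < s + t by rewrite addr_gt0.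
  (* This weight satisfies [q * t = (1 - q) * s], so the multiples of [e] cancel in the convex
     combination and the bound on [K] applies. *)
  have [q qE] : exists q, q = s / (s + t) by exists (s / (s + t)).
  have qs : (s + t) * q = s by rewrite qE; field; rewrite gt_eqF.
  have qt : (s + t) * (1 - q) = t by rewrite mulrBr qs; ring.
  have q01 : 0 <= q <= 1.
    by rewrite qE ler_pdivrMr// mul1r lerDl (ltW t0) divr_ge0// ltW.
  have h1 : q * k.2 + (1 - q) * k'.2 <= _ := Kp _ (convex_setP cK Kk Kk' q01).
  have h2 := convex_functionP cp (k.1 + t *: e) (k'.1 - s *: e) q01.
  have eqv : q *: (k.1 + t *: e) + (1 - q) *: (k'.1 - s *: e) =
      q *: k.1 + (1 - q) *: k'.1.
    rewrite !scalerDr scalerN !scalerA addrACA.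
    rewrite (_ : q * t = (1 - q) * s) ?subrr ?addr0//.
    by rewrite -{1}qt -{2}qs; ring.
  rewrite eqv in h2.
  move: (le_trans h1 h2) => /(ler_wpM2l (ltW st0)).
  rewrite !mulrDr !mulrA qs qt; lra.
have L0 : L !=set0.
  by exists ((k0.2 - p (k0.1 - 1 *: e)) / 1), k0, 1.
have Lub : has_ubound L.
  by exists ((p (k0.1 + 1 *: e) - k0.2) / 1) => x Lx; exact: LU.
exists (sup L) => k t Kk.
have [t0|t0|->] := ltgtP t 0.
- have : (k.2 - p (k.1 - (- t) *: e)) / (- t) <= sup L.
    by apply: ub_le_sup => //; exists k, (- t); rewrite oppr_gt0.
  by rewrite ler_pdivrMr ?oppr_gt0// scaleNr opprK; lra.
- have : sup L <= (p (k.1 + t *: e) - k.2) / t.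
    by apply: ge_sup => // x Lx; exact: LU.
  by rewrite ler_pdivlMr//; lra.
- by rewrite mul0r scale0r !addr0; exact: Kp.
Qed.

(** The functional is extended one vector at a time. Working with coefficients rather than a
    subspace avoids any independence condition on [b]: the set [K] below may a priori hold several
    values over one vector. *)
Lemma hahn_banach_coord {V : lmodType R} (p : V -> R) (I : eqType) (b : I -> V)
    (r : seq I) : convex_function setT p -> 0 <= p 0 -> uniq r ->
  exists a : I -> R, forall c : I -> R,
    \sum_(i <- r) c i * a i <= p (\sum_(i <- r) c i *: b i).
Proof.
move=> cp p0; elim: r => [|j r IH] /=.
  by exists (fun=> 0) => c; rewrite !big_nil.
move=> /andP[jr /IH[a ha]].
pose K := [set k : V * R^o | exists c : I -> R,
  k = (\sum_(i <- r) c i *: b i, \sum_(i <- r) c i * a i)].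
have [| | |al hal] := @hahn_banach_step V p K (b j) cp; last 1 first.
- exists (fun i => if i == j then al else a i) => c.
  rewrite !big_cons eqxx addrC [X in p X]addrC.
  rewrite (eq_big_seq (fun i => c i * a i)); last first.
    by move=> i ir; case: eqP => // ij; rewrite -ij ir in jr.
  by apply: (hal (_, _)); exists c.
- by exists (0, 0), (fun=> 0); rewrite !big1// => i _; rewrite ?scale0r ?mul0r.
- move=> x y l /set_mem[c ->] /set_mem[d ->]; apply: mem_set.
  exists (fun i => l%:num * c i + (1 - l%:num) * d i); congr pair => /=.
    rewrite !scaler_sumr -big_split/=; apply: eq_bigr => i _.
    by rewrite [RHS]scalerDl !scalerA.
  change (l%:num * (\sum_(i <- r) c i * a i) +
    (1 - l%:num) * \sum_(i <- r) d i * a i =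
    \sum_(i <- r) (l%:num * c i + (1 - l%:num) * d i) * a i).
  rewrite !mulr_sumr -big_split/=; apply: eq_bigr => i _.
  by rewrite [RHS]mulrDl !mulrA.
- by move=> k [c ->]; exact: ha.
Qed.

End convexity.

(** * Subgradients and continuity of convex functions in finite dimension *)

Section convex_euclidean.
Context {R : realType} {E : euclidType R}.

Lemma convex_subgradient0 (p : E -> R) : convex_function setT p -> 0 <= p 0 ->
  exists w, forall v, inner w v <= p v.
Proof.
move=> cp p0; pose b (i : 'I_(\dim {:E})) := (vbasis {:E})`_i.
have [a ha] := hahn_banach_coord b cp p0 (index_enum_uniq _).
pose l (v : E) : R^o := \sum_i coord (vbasis {:E}) i v * a i.
have l_lin : linear l.
  move=> k u v; rewrite /l scaler_sumr -big_split; apply: eq_bigr => i _ /=.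
  by rewrite linearP /= mulrDl -mulrA.
have [w lw] := riesz (HB.pack_for {linear E -> R^o} l
  (GRing.isLinear.Build _ _ _ _ _ l_lin)).
exists w => v; rewrite -lw /=.
by apply: le_trans (ha _) _; rewrite /b -coord_vbasis ?memvf.
Qed.

(** An upper bound [K] near [y], supplied by a box, suffices: convexity along lines through [y]
    turns it into a two-sided estimate that shrinks linearly with [t]. *)
Lemma convex_continuous (g : E -> R) :
  convex_function setT g -> continuous (g : E -> R^o).
Proof.
move=> cg y; pose b (i : 'I_(\dim {:E})) := (vbasis {:E})`_i.
have [K hK] := convex_box_bound b (index_enum _) y cg.
have hball : \forall v \near (0 : E), g (y + v) <= K.
  have : \forall v \near (0 : E), forall i, `|coord (vbasis {:E}) i v| <= 1.
    apply: filter_forall => i.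
    have /cvgr_norm_le := @coord_continuous R E i 0.
    by rewrite linear0 normr0; apply.
  apply: filterS => v /hK; rewrite /b -coord_vbasis ?memvf//.
have /nbhs_ballP[r /= r0 hr] := hball.
have gyK : g y <= K by have := nbhs_singleton hball; rewrite /= addr0.
have key v t : `|v| < r -> 0 < t <= 1 ->
    `|g (y + t *: v) - g y| <= t * (K - g y).
  move=> vr /andP[t0 t1].
  have hp : g (y + v) <= K by apply: hr; rewrite -ball_normE /= sub0r normrN.
  have hm : g (y - v) <= K by apply: hr; rewrite -ball_normE /= sub0r !normrN.
  have t01 : 0 <= t <= 1 by rewrite t1 ltW.
  have := convex_functionP cg (y + v) y t01.
  rewrite scalerDr addrAC -scalerDl subrKC scale1r => h1.
  (* With this weight [y] is a convex combination of [y - v] and [y + t *: v], which bounds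
     [g (y + t *: v)] from below. *)
  pose s := t / (1 + t).
  have s0 : 0 < 1 + t by lra.
  have ts : t = s * (1 + t) by rewrite /s divfK ?gt_eqF.
  have os : (1 - s) * (1 + t) = 1 by rewrite mulrBl -ts; ring.
  have s01 : 0 <= s <= 1.
    by rewrite /s ler_pdivrMr// mul1r divr_ge0// ?lerDr //ltW.
  have := convex_functionP cg (y - v) (y + t *: v) s01.
  have -> : s *: (y - v) + (1 - s) *: (y + t *: v) = y.
    rewrite !scalerDr addrACA -scalerDl subrKC scale1r scalerN scalerA.
    rewrite (_ : (1 - s) * t = s) ?addNr ?addr0//.
    by rewrite [in LHS]ts mulrCA os mulr1.
  move=> /(ler_wpM2r (ltW s0)); rewrite mulrDl.
  rewrite (mulrAC s) (mulrAC (1 - s)) -ts os => h2.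
  rewrite ler_norml; apply/andP; split; nra.
apply/cvgrPdist_le => e e0.
(* The added 1 keeps [C] positive when [K = g y], so that [e / C] makes sense. *)
pose C := K - g y + 1.
have C0 : 0 < C by rewrite /C; lra.
pose t := Num.min 1 (e / C).
have t0 : 0 < t by rewrite lt_min ltr01 divr_gt0.
near=> z; rewrite distrC; have -> : z = y + t *: (t^-1 *: (z - y)).
  by rewrite scalerA divff ?gt_eqF// scale1r subrKC.
apply: le_trans (key _ t _ _) _.
- rewrite normrZ ger0_norm ?invr_ge0 ?(ltW t0)// ltr_pdivrMl// distrC.
  near: z; apply/nbhs_ballP; exists (t * r) => /=; first exact: mulr_gt0.
  by move=> z; rewrite -ball_normE.
- by rewrite t0 ge_min lexx.
- have : t * C <= e by rewrite -ler_pdivlMr// ge_min lexx orbT.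
  by rewrite /C; nra.
Unshelve. all: by end_near. Qed.

End convex_euclidean.

(** * Clarke subdifferentials and normal cones *)

Section subdifferentials.
Context {R : realType} {E : euclidType R}.
Implicit Types (x y u v w : E) (phi g : E -> R) (S : set E).

(** Let [q] be the point of [C] nearest to [u]. Its variational inequality [sep], against the
    hypothesis in the direction [u - q], forces [u = q]. *)
Lemma compact_convex_mem (C : set E) u :
  C !=set0 -> compact C -> convex_set C ->
  (forall v, exists2 c, C c & inner u v <= inner c v) -> C u.
Proof.
move=> C0 cC xC hu.
have [|q /set_mem Cq qmin] := compact_EVT_min (f := fun c => `|u - c|) C0 cC.
  apply: continuous_subspaceT => c; apply: cvg_norm.
  by apply: cvgB; [exact: cvg_cst|exact: cvg_id].
have sep c : C c -> inner (u - q) (c - q) <= 0.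
  move=> Cc; rewrite leNgt; apply/negP => ip0.
  set a := inner _ _ in ip0; set b := `|c - q| ^+ 2.
  have b0 : 0 <= b by exact: sqr_ge0.
  have step t : 0 <= t <= 1 -> 2 * t * a <= t ^+ 2 * b.
    move=> t01; have Ct := convex_setP xC Cc Cq t01.
    have : `|u - q| ^+ 2 <= `|u - (t *: c + (1 - t) *: q)| ^+ 2.
      by rewrite ler_sqr ?nnegrE//; exact/qmin/mem_set.
    have -> : u - (t *: c + (1 - t) *: q) = (u - q) - t *: (c - q).
      by rewrite scalerBl scale1r scalerBr addrCA -addrA opprD addrA.
    rewrite [leRHS]sqr_normB innerZr -/a normrZ exprMn.
    by rewrite real_normK ?num_real// -/b; lra.
  have ab0 : 0 < a + b by lra.
  (* Unlike [a / b], this step length stays in [0, 1] and is defined when [b = 0]; it is still short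
     enough to contradict minimality of [q]. *)
  have := step (a / (a + b)).
  rewrite divr_ge0 ?(ltW ip0) ?(ltW ab0)//= ler_pdivrMr// mul1r lerDl b0.
  move=> /(_ erefl).
  move=> /(ler_wpM2r (ltW ab0)) /(ler_wpM2r (ltW ab0)).
  have q1 : a / (a + b) * (a + b) = a by rewrite divfK ?gt_eqF.
  move: q1; set r := a / (a + b) => q1.
  have -> : 2 * r * a * (a + b) * (a + b) =
      2 * (r * (a + b)) * a * (a + b) by ring.
  have -> : r ^+ 2 * b * (a + b) * (a + b) = (r * (a + b)) ^+ 2 * b by ring.
  rewrite q1; have aa := mulr_gt0 ip0 ip0.
  rewrite expr2; nra.
have [c Cc huc] := hu (u - q).
suff -> : u = q by [].
apply/eqP; rewrite -subr_eq0 -inner_eq0 eq_le -sqr_norm_inner sqr_ge0 andbT.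
have := sep c Cc; rewrite sqr_norm_inner (innerBr _ c) (innerBr _ u).
by rewrite (innerC _ u) (innerC _ c); lra.
Qed.

Lemma convex_subgradient_on S g y d :
  compact S -> convex_set S -> convex_function setT g -> S y ->
  (forall z, S z -> inner d (z - y) <= g z - g y) ->
  exists w, (forall z, inner w (z - y) <= g z - g y) /\ normal_cone S y (d - w).
Proof.
move=> cS xS cg Sy dmin.
(* A subgradient at 0 of the convex function v |-> min over z in S of q v z
   works: z = y gives the bound by g, and v = y - z the normal cone condition. *)
pose q v z := g (z + v) - g y - inner d (z - y).
have hz v : exists z, S z /\ forall z', S z' -> q v z <= q v z'.
  have [||z /set_mem Sz zmin] := compact_EVT_min (f := q v) _ cS.
  - by exists y.
  - apply: continuous_subspaceT => z; apply: cvgB.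
      apply: cvgB; last exact: cvg_cst.
      apply: (@continuous_comp _ _ _ (fun z => z + v) (g : E -> R^o)).
        by apply: cvgD; [exact: cvg_id|exact: cvg_cst].
      exact: convex_continuous.
    apply: (@continuous_comp _ _ _ (fun z => z - y) (inner d : E -> R^o)).
      by apply: cvgB; [exact: cvg_id|exact: cvg_cst].
    exact: inner_continuous.
  by exists z; split=> // z' Sz'; apply: zmin; exact: mem_set.
have [Z hZ] := choice hz.
(* Partial minimization of a jointly convex function over a convex set is convex: the combination of
   the minimizers [Z v] and [Z v'] is a competitor at the combined point. *)
have cp : convex_function setT (fun v => q v (Z v)).
  move=> t v v' _ _; have [Sv _] := hZ v; have [Sv' _] := hZ v'.
  have t01 : 0 <= t%:num <= 1 by rewrite ge0 le1.
  have [_] := hZ (t%:num *: v + (1 - t%:num) *: v').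
  move=> /(_ _ (convex_setP xS Sv Sv' t01)) h; apply: le_trans h _.
  have h := convex_functionP cg (Z v + v) (Z v' + v') t01.
  change (q (t%:num *: v + (1 - t%:num) *: v')
      (t%:num *: Z v + (1 - t%:num) *: Z v') <=
    t%:num * q v (Z v) + (1 - t%:num) * q v' (Z v')).
  rewrite /q addrACA -!scalerDr.
  rewrite !innerBr innerDr !innerZr; lra.
have [|w hw] := convex_subgradient0 cp.
  by have [S0 _] := hZ 0; have := dmin _ S0; rewrite /q addr0; lra.
have {}hw v z : S z -> inner w v <= q v z.
  by move=> Sz; apply: le_trans (hw v) _; have [_] := hZ v; exact.
exists w; split => z.
  by have := hw (z - y) y Sy; rewrite /q subrKC subrr linear0r subr0.
move=> Sz; have := hw (y - z) z Sz.
rewrite /q subrKC subrr innerBl -(opprB z) -scaleN1r innerZr; lra.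
Qed.

(** The limsup also sees the quotients whose base point is fixed at [x]. *)
Lemma clarke_dirder_ge phi x v (c : R) :
  (forall e, 0 < e -> \forall t \near 0^'+,
     c - e <= (phi (x + t *: v) - phi x) / t) ->
  (c%:E <= clarke_dirder phi x v)%E.
Proof.
move=> hc; apply: le_ereal_inf_tmp => _ [V [[A B] /= [Ax B0] ABV] <-].
apply/lee_addgt0Pr => e e0.
have : \forall t \near 0^'+, B t /\ c - e <= (phi (x + t *: v) - phi x) / t.
  by apply: filterI => //; exact: hc.
move=> /filter_ex[t [Bt ct]].
rewrite -leeBlDr//.
apply: le_trans (_ : (((phi (x + t *: v) - phi x) / t)%:E <= _)%E).
  by rewrite -EFinB lee_fin.
apply: ereal_sup_ubound; exists (x, t) => //; apply: ABV; split => //=.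
exact: nbhs_singleton.
Qed.

Lemma clarke_dirder_le phi x v (c : R) :
  (\forall z \near x & t \near 0^'+, (phi (z + t *: v) - phi z) / t <= c) ->
  (clarke_dirder phi x v <= c%:E)%E.
Proof.
move=> hc; apply: ge_ereal_inf; eexists; first by eexists; [exact: hc|].
by apply: ge_ereal_sup => _ [p /= hp <-]; rewrite lee_fin.
Qed.

Lemma subgradient_clarke g y w :
  (forall z, inner w (z - y) <= g z - g y) -> clarke_subdiff g y w.
Proof.
move=> hw v; apply: clarke_dirder_ge => e e0; near=> t.
have t0 : 0 < t by near: t; exact: nbhs_right_gt.
rewrite ler_pdivlMr//; have := hw (y + t *: v).
rewrite addrAC subrr add0r innerZr; nra.
Unshelve. all: by end_near. Qed.

(** For [t <= 1] convexity bounds the quotient at base point [x] in direction [z - y] by the full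
    increment [g (x + (z - y)) - g x], which is continuous in [x]. *)
Lemma clarke_subgradient g y w : convex_function setT g ->
  clarke_subdiff g y w -> forall z, inner w (z - y) <= g z - g y.
Proof.
move=> cg hw z; rewrite -lee_fin; apply/lee_addgt0Pr => e e0.
apply: le_trans (hw (z - y)) _; rewrite -EFinD; apply: clarke_dirder_le.
have gc : {for y, continuous (fun x => g (x + (z - y)) - g x : R^o)}.
  apply: cvgB; last exact: convex_continuous.
  apply: (@continuous_comp _ _ _ (fun x => x + (z - y)) (g : E -> R^o)).
    by apply: cvgD; [exact: cvg_id|exact: cvg_cst].
  exact: convex_continuous.
near=> x t => /=.
have t0 : 0 < t by near: t; exact: nbhs_right_gt.
have t1 : t <= 1 by near: t; apply: nbhs_right_le.
rewrite ler_pdivrMr//.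
have h : g (x + (z - y)) - g x <= g z - g y + e.
  have -> : g z = g (y + (z - y)) by rewrite subrKC.
  near: x.
  by have /cvgr_le := gc; apply; rewrite ltrDl.
have t01 : 0 <= t <= 1 by rewrite t1 ltW.
have := convex_functionP cg (x + (z - y)) x t01.
rewrite scalerDr addrAC -scalerDl subrKC scale1r; nra.
Unshelve. all: by end_near. Qed.

End subdifferentials.

(** * Directional derivatives *)

Section directional_derivative.
Context {R : realType} {V : normedModType R} (phi : V -> R^o) (x v : V).
Hypothesis phi_diff : differentiable phi x.

Lemma diff_quotient_cvg :
  (phi (x + t *: v) - phi x) / t @[t --> 0^'+] --> ('d phi x v : R^o).
Proof.
rewrite -deriveE//; apply: cvg_dnbhs_at_right.
have : derivable phi x v by exact: diff_derivable.
rewrite /derivable => /cvg_ex[l hl].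
rewrite /derive (cvg_lim _ hl)//.
rewrite (_ : (fun t => _) =
  fun t : R => t^-1 *: ((phi \o shift x) (t *: v) - phi x) : R^o)//.
by apply/funext => t /=; rewrite addrC mulrC addrC [x + _]addrC.
Qed.

Lemma diff_le (k : R) :
  (\forall t \near 0^'+, phi (x + t *: v) - phi x <= t * k) -> 'd phi x v <= k.
Proof.
move=> hk; apply: (cvgr_to_le diff_quotient_cvg); near=> t.
have t0 : 0 < t by near: t; exact: nbhs_right_gt.
by rewrite ler_pdivrMr// mulrC; near: t.
Unshelve. all: by end_near. Qed.

Lemma diff_ge (k : R) :
  (\forall t \near 0^'+, t * k <= phi (x + t *: v) - phi x) -> k <= 'd phi x v.
Proof.
move=> hk; apply: (cvgr_to_ge diff_quotient_cvg); near=> t.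
have t0 : 0 < t by near: t; exact: nbhs_right_gt.
by rewrite ler_pdivlMr// mulrC; near: t.
Unshelve. all: by end_near. Qed.

End directional_derivative.

Lemma diff_MVT {R : realType} {V : normedModType R} (phi : V -> R^o) (x v : V)
    (t : R) : (forall z, differentiable phi z) -> 0 <= t ->
  exists2 s, 0 <= s <= t & phi (x + t *: v) - phi x = 'd phi (x + s *: v) v * t.
Proof.
move=> dphi t0; pose h (s : R) : R^o := phi (x + s *: v).
have hd (s : R) : is_derive s 1 h ('d phi (x + s *: v) v).
  have eqq : (fun k : R => k^-1 *: ((h \o shift s) (k *: 1) - h s)) =
      (fun k => k^-1 *: ((phi \o shift (x + s *: v)) (k *: v) -
        phi (x + s *: v))).
    apply/funext => k /=; rewrite /h; congr (_ *: (phi _ - _)).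
    by rewrite scalerDl addrCA [k *: 1]mulr1.
  have dd : derivable phi (x + s *: v) v by exact: diff_derivable.
  split; first by rewrite /derivable eqq.
  by rewrite /derive eqq -deriveE.
have [|s] := MVT_segment (f := h) (df := fun s => 'd phi (x + s *: v) v) t0.
  apply: continuous_subspaceT => s.
  by apply/differentiable_continuous/derivable1_diffP; case: (hd s).
rewrite in_itv /= => s01; rewrite /h scale0r addr0 subr0 => ->.
by exists s.
Qed.

(** The gap between the two sides has a minimum at [x], so its differential is nonnegative at both
    [v] and [- v]. *)
Lemma diff_touching_combination {R : realType} {V : normedModType R}
    (p q r : V -> R^o) (x : V) (a b : R) :
  differentiable p x -> differentiable q x -> differentiable r x ->
  (forall z, a * q z + b * r z <= p z) -> p x = a * q x + b * r x ->
  forall v, 'd p x v = a * 'd q x v + b * 'd r x v.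
Proof.
move=> dp dq dr D_ge0 Dx; pose D := p - (a *: q + b *: r).
have dD : differentiable D x.
  exact: differentiableB dp
    (differentiableD (differentiableZ a dq) (differentiableZ b dr)).
have diffDE v : 'd D x v = 'd p x v - (a * 'd q x v + b * 'd r x v).
  rewrite -(deriveE v dD) -(deriveE v dp) -(deriveE v dq) -(deriveE v dr).
  have {}dp : derivable p x v by exact: diff_derivable.
  have {}dq : derivable q x v by exact: diff_derivable.
  have {}dr : derivable r x v by exact: diff_derivable.
  have daq := derivableZ (k := a) dq; have dbr := derivableZ (k := b) dr.
  rewrite /D (deriveB dp (derivableD daq dbr)) (deriveD daq dbr).
  by rewrite (deriveZ a dq) (deriveZ b dr).
have dD_ge0 v : 0 <= 'd D x v.
  apply: diff_ge => //; near=> t; rewrite mulr0.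
  have : D x = 0 by rewrite /D !fctE Dx subrr.
  move=> ->; rewrite subr0; rewrite /D !fctE subr_ge0; exact: D_ge0.
move=> v; apply/eqP; rewrite -subr_eq0 -diffDE eq_le dD_ge0 andbT.
by rewrite -oppr_ge0 -linearN.
Unshelve. all: by end_near. Qed.

(** * Value function of the inner maximization *)

Section minimax.
Context {R : realType} {E1 E2 : euclidType R}.
Variables (S : set E2) (f : E1 -> E2 -> R) (g : E2 -> R).
Hypotheses (S_nonempty : S !=set0) (S_compact : compact S).
Hypothesis f_C1 : class_C 1 setT (fun z : E1 * E2 => f z.1 z.2 : R^o).
Hypothesis g_continuous : continuous (g : E2 -> R^o).

Let F (z : E1 * E2) : R^o := f z.1 z.2.

Let F_diff z : differentiable F z. Proof. by case: f_C1 => + _; exact. Qed.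

Let F_continuous : continuous F.
Proof. by move=> z; exact: differentiable_continuous. Qed.

Let pairl_diff (y : E2) (x : E1) : differentiable (fun x : E1 => (x, y)) x.
Proof. exact: differentiable_pair. Qed.

Let pairr_diff (x : E1) (y : E2) : differentiable (fun y : E2 => (x, y)) y.
Proof. exact: differentiable_pair. Qed.

Lemma differentiable_fl y x : differentiable (f ^~ y : E1 -> R^o) x.
Proof. by apply: (@differentiable_comp _ _ _ _ (fun x => (x, y)) F). Qed.

Lemma differentiable_fr x y : differentiable (f x : E2 -> R^o) y.
Proof. by apply: (@differentiable_comp _ _ _ _ (fun y => (x, y)) F). Qed.

Lemma inner_grad_x x y v : inner (grad_x f x y) v = 'd F (x, y) (v, 0).
Proof.
rewrite /grad_x -gradE.
rewrite (@diff_comp _ _ _ _ (fun x => (x, y)) F)//=.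
by rewrite diff_pair//= diff_cst diff_val.
Qed.

(** [class_C] gives continuity of the differential only for each fixed direction, which is exactly
    weak continuity of the gradient. *)
Lemma grad_x_continuous : continuous (fun z : E1 * E2 => grad_x f z.1 z.2).
Proof.
move=> z; apply: continuous_inner_all => v.
have [_ /(_ (v, 0))/(_ z I)] := f_C1.
rewrite (_ : (fun x => 'd _ x (v, 0)) =
  fun t : E1 * E2 => inner (grad_x f t.1 t.2) v)//.
by apply/funext => -[x y]; rewrite inner_grad_x.
Qed.

Definition maximizers (x : E1) : set E2 :=
  [set y | S y /\ forall z, S z -> f x z - g z <= f x y - g y].

Let payoff_continuous : continuous (fun z : E1 * E2 => f z.1 z.2 - g z.2 : R^o).
Proof.
move=> z; apply: cvgB; first exact: F_continuous.
apply: (@continuous_comp _ _ _ snd (g : E2 -> R^o)); last exact: g_continuous.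
by case: z => ? ?; exact: cvg_snd.
Qed.

Let payoff_continuousr x : continuous (fun y => f x y - g y : R^o).
Proof.
move=> y; apply: (@continuous_comp _ _ _ (fun y => (x, y))
  (fun z : E1 * E2 => f z.1 z.2 - g z.2 : R^o)).
  exact: differentiable_continuous.
exact: payoff_continuous.
Qed.

Lemma maximizers_nonempty x : maximizers x !=set0.
Proof.
have [|y /set_mem Sy ymax] :=
    compact_EVT_max (f := fun y => f x y - g y) S_nonempty S_compact.
  exact/continuous_subspaceT/payoff_continuousr.
by exists y; split=> // z Sz; apply: ymax; exact: mem_set.
Qed.

Lemma value_fun_maximizer x y : maximizers x y ->
  value_fun S f g x = f x y - g y.
Proof.
move=> [Sy ymax]; apply/eqP; rewrite eq_le; apply/andP; split.
  by apply: ge_sup => [|_ [z Sz <-]]; [exists (f x y - g y), y|exact: ymax].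
apply: ub_le_sup; last by exists y.
by exists (f x y - g y) => _ [z Sz <-]; exact: ymax.
Qed.

Lemma value_fun_ge x y : S y -> f x y - g y <= value_fun S f g x.
Proof.
move=> Sy; have [z zmax] := maximizers_nonempty x.
by rewrite (value_fun_maximizer zmax); apply: zmax.2.
Qed.

(** The function [f ^~ y] minus the constant [g y] lies below the value function and touches it at
    [x], so its difference quotients at [x] are smaller. *)
Lemma grad_x_clarke x y : maximizers x y ->
  clarke_subdiff (value_fun S f g) x (grad_x f x y).
Proof.
move=> ymax v; have [Sy _] := ymax; apply: clarke_dirder_ge => e e0.
have fq := diff_quotient_cvg (v := v) (differentiable_fl y x).
rewrite /grad_x -gradE; near=> t.
have t0 : 0 < t by near: t; exact: nbhs_right_gt.
have : 'd (f ^~ y : E1 -> R^o) x v - e <= (f (x + t *: v) y - f x y) / t.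
  by near: t; have /cvgr_ge := fq; apply; lra.
move=> /le_trans; apply.
rewrite ler_pM2r ?invr_gt0// (value_fun_maximizer ymax).
by have := value_fun_ge (x + t *: v) Sy; lra.
Unshelve. all: by end_near. Qed.

(** If [y] is a maximizer at the end point [z + t *: v], the increment of the value function is at
    most that of [f ^~ y], hence by the mean value theorem at most [t] times a partial derivative at
    an intermediate point. It remains to make the bound by [c] uniform near [x]. *)
Lemma value_fun_clarke_dirder_le x v (c : R) :
  (forall y, maximizers x y -> inner (grad_x f x y) v < c) ->
  (clarke_dirder (value_fun S f g) x v <= c%:E)%E.
Proof.
move=> hc; apply: clarke_dirder_le.
(* The two components separate the point where [y] is a maximizer from the point where the gradient
   is taken. Compactness of [S] reduces the claim to each [y]: near a maximizer at [x] the strict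
   inequality persists, and near any other [y] a strictly better [z] stays better, so no nearby
   point is a maximizer. *)
have : \forall z \near (x, x), S `<=`
    [set y | maximizers z.1 y -> inner (grad_x f z.2 y) v < c].
  have /compact_near_coveringP S_cover := S_compact.
  apply: (S_cover _ (nbhs (x, x)) (fun z y =>
    maximizers z.1 y -> inner (grad_x f z.2 y) v < c)) => y Sy.
  have [ymax|ynmax] := pselect (maximizers x y).
    have : \forall z \near (x, y), inner (grad_x f z.1 z.2) v < c.
      have : {for (x, y), continuous
          (fun z : E1 * E2 => inner v (grad_x f z.1 z.2) : R^o)}.
        apply: (@continuous_comp _ _ _ (fun z : E1 * E2 => grad_x f z.1 z.2)
          (inner v : E1 -> R^o)); first exact: grad_x_continuous.
        exact: inner_continuous.
      move=> /cvgr_lt/(_ c); rewrite innerC => /(_ (hc y ymax)).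
      by apply: filterS => z; rewrite innerC.
    case=> -[A B] /= [Ax By] AB.
    exists (B, [set z | A z.2]) => /=.
      split=> //; exists (setT, A) => /=; last by move=> ? [].
      by split=> //; exact: filterT.
    by move=> [y' z'] /= [By' Az'] _; exact: (AB (z'.2, y')).
  have [z [Sz yz]] : exists z, S z /\ f x y - g y < f x z - g z.
    apply: contrapT => /forallNP hz; apply: ynmax; split=> // z Sz.
    by rewrite leNgt; apply/negP => yz; apply: (hz z).
  have : \forall z' \near (x, y), f z'.1 z'.2 - g z'.2 < f z'.1 z - g z.
    have : {for (x, y), continuous (fun z' : E1 * E2 =>
        (f z'.1 z - g z) - (f z'.1 z'.2 - g z'.2) : R^o)}.
      apply: cvgB; last exact: payoff_continuous.
      apply: (@continuous_comp _ _ _ (fun z' : E1 * E2 => (z'.1, z))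
        (fun z : E1 * E2 => f z.1 z.2 - g z.2 : R^o));
        last exact: payoff_continuous.
      by apply: cvg_pair => //=; [exact: cvg_fst|exact: cvg_cst].
    move=> /cvgr_gt/(_ 0); rewrite subr_gt0 => /(_ yz).
    by apply: filterS => z'; rewrite subr_gt0.
  case=> -[A B] /= [Ax By] AB.
  exists (B, [set z | A z.1]) => /=.
    split=> //; exists (A, setT) => /=; last by move=> ? [].
    by split=> //; exact: filterT.
  move=> [y' z'] /= [By' Az'] [_ /(_ z Sz)].
  by rewrite leNgt (AB (z'.1, y')).
move=> /nbhs_ballP[r /= r0 hr].
have {}hr z1 z2 y : `|x - z1| < r -> `|x - z2| < r -> maximizers z1 y ->
    inner (grad_x f z2 y) v < c.
  move=> z1r z2r ymax; apply: (hr (z1, z2)) => //; last by case: ymax.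
  by split; rewrite -ball_normE.
have r2 : 0 < r / 2 by rewrite divr_gt0.
have v1 : 0 < `|v| + 1 by rewrite ltr_wpDl.
near=> z t.
have zr : `|x - z| < r / 2.
  near: z; apply/nbhs_ballP; exists (r / 2) => //= z; by rewrite -ball_normE.
have t0 : 0 < t by near: t; exact: nbhs_right_gt.
(* This keeps the whole segment from [z] to [z + t *: v] within [r] of [x]; the added 1 covers
   [v = 0]. *)
have tr : t < r / 2 / (`|v| + 1).
  by near: t; apply: nbhs_right_lt; rewrite divr_gt0.
have close s : 0 <= s <= t -> `|x - (z + s *: v)| < r.
  move=> /andP[s0 st]; rewrite opprD addrA.
  apply: le_lt_trans (ler_normB _ _) _.
  rewrite normrZ (ger0_norm s0); move: tr; rewrite ltr_pdivlMr// => tr.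
  by have := ler_wpM2r (normr_ge0 v) st; lra.
rewrite ler_pdivrMr//.
have [y ymax] := maximizers_nonempty (z + t *: v).
have [Sy _] := ymax.
rewrite (value_fun_maximizer ymax).
have [s st fs] := diff_MVT z v (differentiable_fl y) (ltW t0).
have Phi_ge := value_fun_ge z Sy.
have : inner (grad_x f (z + s *: v) y) v < c.
  by apply: (hr (z + t *: v)) => //; apply: close => //; rewrite lexx ltW.
rewrite /grad_x -gradE => /ltW/(ler_wpM2r (ltW t0)); rewrite -fs /=; lra.
Unshelve. all: by end_near. Qed.

End minimax.

(** * Optimality conditions and Clarke subgradients under concavity in [y] *)

Section concave.
Context {R : realType} {E1 E2 : euclidType R}.
Variables (S : set E2) (f : E1 -> E2 -> R) (g : E2 -> R).
Hypotheses (S_nonempty : S !=set0) (S_compact : compact S).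
Hypothesis S_convex : convex_set S.
Hypothesis f_C1 : class_C 1 setT (fun z : E1 * E2 => f z.1 z.2 : R^o).
Hypothesis f_concave : forall x, convex_function setT (fun y => - f x y).
Hypothesis g_convex : convex_function setT g.

Let g_continuous := convex_continuous g_convex.
Let maximizers := maximizers S f g.

Let f_concaveP x y z t : 0 <= t <= 1 ->
  t * f x y + (1 - t) * f x z <= f x (t *: y + (1 - t) *: z).
Proof. by move=> /(convex_functionP (f_concave x) y z); lra. Qed.

Lemma concave_grad_y x y z : f x z - f x y <= inner (grad_y f x y) (z - y).
Proof.
rewrite /grad_y -gradE; apply: diff_ge; first exact: differentiable_fr.
near=> t.
have t0 : 0 < t by near: t; exact: nbhs_right_gt.
have t1 : t <= 1 by near: t; apply: nbhs_right_le.
have t01 : 0 <= t <= 1 by rewrite t1 ltW.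
have := f_concaveP x z y t01; rewrite (conv_line t y z) => h.
change (t * (f x z - f x y) <= f x (y + t *: (z - y)) - f x y). lra.
Unshelve. all: by end_near. Qed.

Lemma maximizersP x y : maximizers x y <->
  S y /\ exists w m : E2, [/\ clarke_subdiff g y w, normal_cone S y m &
                              0 = grad_y f x y - w - m].
Proof.
split=> [[Sy ymax]|[Sy [w [m [gw Sm gwm]]]]]; split => //.
  (* The first-order condition comes from comparing [y] with [y + t *: (z - y)], bounding the
     increment of [g] by convexity and letting [t] tend to 0. *)
  have [z Sz|w [gw Sw]] := convex_subgradient_on (d := grad_y f x y)
    S_compact S_convex g_convex Sy.
    rewrite /grad_y -gradE; apply: diff_le; first exact: differentiable_fr.
    near=> t.
    have t0 : 0 < t by near: t; exact: nbhs_right_gt.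
    have t1 : t <= 1 by near: t; apply: nbhs_right_le.
    have t01 : 0 <= t <= 1 by rewrite t1 ltW.
    have := ymax _ (convex_setP S_convex Sz Sy t01).
    have := convex_functionP g_convex z y t01.
    rewrite (conv_line t y z).
    lra.
  exists w, (grad_y f x y - w); split; [exact: subgradient_clarke|by []|].
  by rewrite subrr.
move=> z Sz; have := clarke_subgradient g_convex gw z.
have := concave_grad_y x y z; have := Sm z Sz.
have -> : grad_y f x y = w + m.
  by apply/eqP; rewrite -subr_eq0 opprD addrA -gwm.
rewrite innerDl; lra.
Unshelve. all: by end_near. Qed.

Let maximizer_combination x y0 y1 t z : maximizers x y0 -> maximizers x y1 ->
  0 <= t <= 1 -> S z ->
  f x z - g z <= t * f x y0 + (1 - t) * f x y1 - g (t *: y0 + (1 - t) *: y1).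
Proof.
move=> [Sy0 max0] [Sy1 max1] t01 Sz.
have := convex_functionP g_convex y0 y1 t01.
have := max0 z Sz; have := max1 z Sz; move/andP: t01 => [t0 t1] h1 h0.
have := ler_wpM2l t0 h0.
have : (1 - t) * (f x z - g z) <= (1 - t) * (f x y1 - g y1).
  by apply: ler_wpM2l h1; lra.
lra.
Qed.

Lemma maximizers_convex x : convex_set (maximizers x).
Proof.
move=> y0 y1 l /set_mem max0 /set_mem max1; apply: mem_set.
change (maximizers x (l%:num *: y0 + (1 - l%:num) *: y1)).
have t01 : 0 <= l%:num <= 1 by rewrite ge0 le1.
split; first exact: (convex_setP S_convex (proj1 max0) (proj1 max1) t01).
move=> z Sz; apply: le_trans (maximizer_combination max0 max1 t01 Sz) _.
by rewrite lerD2r; exact: f_concaveP.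
Qed.

Lemma grad_x_maximizers_affine x y0 y1 t :
  maximizers x y0 -> maximizers x y1 -> 0 <= t <= 1 ->
  grad_x f x (t *: y0 + (1 - t) *: y1) =
  t *: grad_x f x y0 + (1 - t) *: grad_x f x y1.
Proof.
move=> max0 max1 t01; set yt := t *: y0 + _.
have Syt : S yt by exact: (convex_setP S_convex (proj1 max0) (proj1 max1) t01).
have ft_ge x' : t * f x' y0 + (1 - t) * f x' y1 <= f x' yt by exact: f_concaveP.
have ft_eq : f x yt = t * f x y0 + (1 - t) * f x y1.
  apply/eqP; rewrite eq_le ft_ge andbT.
  (* Testing against [yt] itself cancels the term in [g] and leaves the inequality opposite to
     concavity. *)
  have := maximizer_combination max0 max1 t01 Syt; rewrite -/yt; lra.
have fd y := differentiable_fl f_C1 y x.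
have fE := diff_touching_combination (fd yt) (fd y0) (fd y1) ft_ge ft_eq.
apply: inner_inj => v; have := fE v; rewrite !gradE /grad_x.
move: (grad _ x) (grad (f ^~ y0) x) (grad (f ^~ y1) x) => wt w0 w1.
by rewrite innerDl !innerZl.
Qed.

Lemma maximizers_compact x : compact (maximizers x).
Proof.
have -> : maximizers x = S `&`
    [set y | value_fun S f g x <= f x y - g y].
  apply/seteqP; split=> y [Sy ymax]; split=> //=.
    by rewrite (value_fun_maximizer (conj Sy ymax)).
  move=> z Sz; apply: le_trans ymax; exact: value_fun_ge.
apply: compact_closedI => //.
apply: (@preimage_closed _ _ (fun y => f x y - g y : R^o)
  [set r | value_fun S f g x <= r]).
  move=> y _; apply: cvgB; last exact: g_continuous.
  by apply/differentiable_continuous/differentiable_fr.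
exact: closed_ge.
Qed.

Lemma clarke_value_fun x u : clarke_subdiff (value_fun S f g) x u ->
  exists2 y, maximizers x y & u = grad_x f x y.
Proof.
move=> hu; suff [y ymax yu] : (grad_x f x @` maximizers x) u by exists y.
have C_nonempty : grad_x f x @` maximizers x !=set0.
  by apply: image_nonempty; exact: maximizers_nonempty.
have C_compact : compact (grad_x f x @` maximizers x).
  apply: continuous_compact; last exact: maximizers_compact.
  apply: continuous_subspaceT => y.
  apply: (@continuous_comp _ _ _ (fun y => (x, y))
    (fun z : E1 * E2 => grad_x f z.1 z.2)).
    by apply: cvg_pair => //=; exact: cvg_cst.
  exact: grad_x_continuous.
apply: compact_convex_mem => //.
  move=> _ _ l /set_mem[y0 max0 <-] /set_mem[y1 max1 <-]; apply: mem_set.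
  exists (l%:num *: y0 + (1 - l%:num) *: y1).
    exact/set_mem/(maximizers_convex (x := x) l (mem_set max0) (mem_set max1)).
  by apply: grad_x_maximizers_affine => //; rewrite ge0 le1.
move=> v.
have [|c /set_mem Cc cmax] :=
    compact_EVT_max (f := fun c => inner v c) C_nonempty C_compact.
  by apply: continuous_subspaceT => c; exact: inner_continuous.
exists c => //; rewrite leNgt; apply/negP => cu.
(* The midpoint serves as [c] because the bound on the Clarke derivative needs a constant strictly
   above the maximum of [inner v] over the gradients, yet still below [inner u v]. *)
have : ((inner u v)%:E <= ((inner u v + inner c v) / 2)%:E)%E.
  apply: le_trans (hu v) _; apply: value_fun_clarke_dirder_le => // y ymax.
  have := cmax (grad_x f x y) (mem_set (ex_intro2 _ _ y ymax erefl)).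
  by rewrite (innerC v) (innerC v); lra.
rewrite lee_fin; lra.
Qed.

End concave.

(** * Equivalence of the two notions of stationarity *)

Unset Implicit Arguments.

Theorem proposition3 (R : realType) (E1 E2 : euclidType R)
    (M : set E1) (S : set E2)
    (f : E1 -> E2 -> R) (h : E1 -> R) (g : E2 -> R) (Lx Ly Lh : R)
    (M_submanifold : embedded_submanifold M) (M_compact : compact M)
    (S_nonempty : S !=set0) (S_compact : compact S) (S_convex : convex_set S)
    (f_C1 : class_C 1 setT (fun z : E1 * E2 => f z.1 z.2 : R^o))
    (f_concave : forall x, convex_function setT (fun y => - f x y))
    (h_convex : convex_function setT h) (h_closed : closed_fun h)
    (g_convex : convex_function setT g) (g_closed : closed_fun g)
    (Lx_gt0 : 0 < Lx) (Ly_gt0 : 0 < Ly)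
    (grad_x_lipschitz : forall x1 x2 y, M x1 -> M x2 -> S y ->
       `|grad_x f x1 y - grad_x f x2 y| <= Lx * `|x1 - x2|)
    (grad_y_lipschitz : forall x1 x2 y1 y2, M x1 -> M x2 -> S y1 -> S y2 ->
       `|grad_y f x1 y1 - grad_y f x2 y2| ^+ 2 <=
       Ly ^+ 2 * (`|x1 - x2| ^+ 2 + `|y1 - y2| ^+ 2))
    (h_lipschitz : forall x1 x2, `|h x1 - h x2| <= Lh * `|x1 - x2|) :
  (forall x, optimization_stationary M S f h g x ->
     exists2 y, S y & game_stationary M S f h g x y) /\
  (forall x y, game_stationary M S f h g x y ->
     optimization_stationary M S f h g x).
Proof.
split=> [x [Mx [u [v [n [Pu hv Nn uvn]]]]]|x y [Mx Sy [v [n [hv Nn uvn]]] ywm]].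
  have [y ymax uE] := clarke_value_fun S_nonempty S_compact S_convex f_C1
    f_concave g_convex Pu.
  have /(maximizersP S_compact S_convex f_C1 f_concave g_convex)[Sy ywm] :=
    ymax.
  by exists y => //; split=> //; exists v, n; rewrite -uE.
split=> //; exists (grad_x f x y), v, n; split=> //.
apply: grad_x_clarke => //; first exact: convex_continuous.
exact/(maximizersP S_compact S_convex f_C1 f_concave g_convex).
Qed.
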